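(* There exists a left-orderable group $G$ with cardinality equal to that of $\mathrm{Homeo}_+(\mathbb{R})$ such that $G$ does not embed in $\mathrm{Homeo}_+(\mathbb{R})$, i.e. there is no injective group homomorphism $G \to \mathrm{Homeo}_+(\mathbb{R})$.
   Context: A group $G$ is left-orderable if there is a total order on $G$ that is invariant under left multiplication. $\mathrm{Homeo}_+(\mathbb{R})$ is the group (under composition) of orientation-preserving homeomorphisms of $\mathbb{R}$. *)

(* Defs.v *)
From HB Require Import structures.
From mathcomp Require Import all_boot all_order all_algebra.
From mathcomp Require Import boolp classical_sets functions cardinality reals.
From mathcomp Require Import topology normedtype.

Set Implicit Arguments.
Unset Strict Implicit.
Unset Printing Implicit Defensive.

Import Order.TTheory GRing.Theory Num.Theory.
Import numFieldNormedType.Exports.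

Local Open Scope classical_set_scope.
Local Open Scope ring_scope.

Definition left_orderable (G : groupType) : Prop :=
  exists le : rel G,
    [/\ reflexive le, antisymmetric le, transitive le, total le &
        forall g x y : G, le x y -> le (g * x)%g (g * y)%g].

Definition homeomorphism (T U : topologicalType) (f : T -> U) : Prop :=
  exists g : U -> T, [/\ cancel f g, cancel g f, continuous f & continuous g].

(* A homeomorphism of the line preserves orientation iff it is increasing. *)
Definition orientation_preserving (R : realType) (f : R -> R) : Prop :=
  {homo f : x y / x < y}.

Definition is_homeo_plus (R : realType) : pred (R -> R) :=
  fun f => `[< homeomorphism f /\ orientation_preserving f >].

Record homeo_plus (R : realType) := HomeoPlus {
  homeo_plus_fun :> R -> R;
  homeo_plus_subproof : is_homeo_plus homeo_plus_fun }.

HB.instance Definition _ (R : realType) :=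
  [isSub for @homeo_plus_fun R].
HB.instance Definition _ (R : realType) := [Choice of homeo_plus R by <:].

Section HomeoPlusGroup.
Variable R : realType.
Implicit Types f g h : homeo_plus R.

Lemma homeo_plusP f : homeomorphism f /\ orientation_preserving f.
Proof. exact/asboolP/(homeo_plus_subproof f). Qed.

Lemma homeo_plus_eq f g : f =1 g -> f = g.
Proof. by move=> fg; apply/val_inj/funext. Qed.

Lemma is_homeo_plus_id : is_homeo_plus (@id R).
Proof.
by apply/asboolP; split=> //; exists id; split=> // x; exact: cvg_id.
Qed.

Lemma is_homeo_plus_comp f g : is_homeo_plus (f \o g).
Proof.
apply/asboolP; have [[f' [fK f'K cf cf']] fi] := homeo_plusP f.
have [[g' [gK g'K cg cg']] gi] := homeo_plusP g.
split; last by move=> x y xy /=; apply/fi/gi.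
exists (g' \o f'); split; [exact: can_comp|exact: can_comp| |].
- by move=> x; apply: continuous_comp; [exact: cg|exact: cf].
- by move=> x; apply: continuous_comp; [exact: cf'|exact: cg'].
Qed.

Definition homeo_plus_inv_fun f : R -> R := sval (cid (homeo_plusP f).1).

Lemma homeo_plus_inv_funP f :
  [/\ cancel f (homeo_plus_inv_fun f), cancel (homeo_plus_inv_fun f) f,
      continuous f & continuous (homeo_plus_inv_fun f)].
Proof. exact: (svalP (cid (homeo_plusP f).1)). Qed.

Lemma is_homeo_plus_inv f : is_homeo_plus (homeo_plus_inv_fun f).
Proof.
have [fK f'K cf cf'] := homeo_plus_inv_funP f.
apply/asboolP; split; first by exists f.
move=> x y; apply: contraLR; rewrite -!leNgt => yx.
rewrite -[x]f'K -[y]f'K; move: yx; rewrite !le_eqVlt => /predU1P[->|yx].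
  by rewrite eqxx.
by rewrite ((homeo_plusP f).2 _ _ yx) orbT.
Qed.

Definition homeo_plus_one : homeo_plus R := HomeoPlus is_homeo_plus_id.
Definition homeo_plus_mul f g : homeo_plus R :=
  HomeoPlus (is_homeo_plus_comp f g).
Definition homeo_plus_inv f : homeo_plus R := HomeoPlus (is_homeo_plus_inv f).

Lemma homeo_plus_mulA : associative homeo_plus_mul.
Proof. by move=> f g h; exact: homeo_plus_eq. Qed.

Lemma homeo_plus_mul1 : left_id homeo_plus_one homeo_plus_mul.
Proof. by move=> f; exact: homeo_plus_eq. Qed.

Lemma homeo_plus_mulr1 : right_id homeo_plus_one homeo_plus_mul.
Proof. by move=> f; exact: homeo_plus_eq. Qed.

Lemma homeo_plus_mulV : left_inverse homeo_plus_one homeo_plus_inv homeo_plus_mul.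
Proof.
by move=> f; apply: homeo_plus_eq => x /=; have [fK _ _ _] := homeo_plus_inv_funP f.
Qed.

Lemma homeo_plus_mulrV :
  right_inverse homeo_plus_one homeo_plus_inv homeo_plus_mul.
Proof.
by move=> f; apply: homeo_plus_eq => x /=; have [_ f'K _ _] := homeo_plus_inv_funP f.
Qed.

End HomeoPlusGroup.

HB.instance Definition _ (R : realType) := isGroup.Build (homeo_plus R)
  (@homeo_plus_mulA R) (@homeo_plus_mul1 R) (@homeo_plus_mulr1 R)
  (@homeo_plus_mulV R) (@homeo_plus_mulrV R).

(* Main.v *)
Require Import Defs.
From HB Require Import structures.
From mathcomp Require Import all_boot all_order all_algebra.
From mathcomp Require Import boolp classical_sets functions cardinality reals.
From mathcomp Require Import topology normedtype wochoice.
From mathcomp Require Import ring lra zify.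

Set Implicit Arguments.
Unset Strict Implicit.
Unset Printing Implicit Defensive.

Import Order.TTheory GRing.Theory Num.Theory.
Import numFieldNormedType.Exports.

Local Open Scope classical_set_scope.
Local Open Scope card_scope.
Local Open Scope ring_scope.

(** The group is a power of the Klein bottle group
    K = < a, b | b^-1 a b = a^-1 >, with one factor K_i for each i in an index
    set of the cardinality of the continuum; its elements are the families
    whose support is countable.

    Why it does not act faithfully on the line.  Let a_i, b_i be the images of
    the generators of K_i in Homeo_+(R).  As a_i is not the identity and b_i
    conjugates it to its inverse, a_i moves some point to the right: if it
    moves x to the left, then it moves b_i(x) to the right.  Hence a_i moves
    every point of some interval ]p, q[ with rational ends to the right, and
    every point of b_i(]p, q[) to the left.  Choose a rational r in that second
    interval.  If j is another index, b_i commutes with a_j; so if j had the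
    same p and q, then a_j would move every point of b_i(]p, q[) to the right,
    whereas it moves every point of b_j(]p, q[) to the left; the rational r
    cannot lie in both.  Thus i is determined by (p, q, r), and there are only
    countably many indices ([klein_family_countable]).

    Why it is left-orderable.  K is, lexicographically
    ([klein_left_orderable]), and a power of a left-orderable group is too:
    well-order the indices and compare two families at the first index where
    they differ ([sigma_power_left_orderable]).

    Why it has the right cardinality.  A homeomorphism of the line is
    determined by a set of pairs of rationals, and the subsets of nat embed in
    R, hence in the translations.  A family with countable support is
    determined by a sequence of indices and a sequence of values.  So all the
    sets involved have the cardinality of [set nat], by Cantor-Bernstein. *)

(** * Increasing homeomorphisms of the line *)

Lemma injective_card_le (T U : Type) (f : T -> U) :
  injective f -> [set: T] #<= [set: U].
Proof.
move=> finj; have [g] : $|{injfun [set: T] >-> [set: U]}|.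
  by apply/injfunPex; exists f => // x y _ _ /finj.
exact: inj_card_le.
Qed.

Lemma homeo_plus_lt (R : realType) (f : homeo_plus R) x y : x < y -> f x < f y.
Proof. exact: (homeo_plusP f).2. Qed.

Lemma homeo_plusK (R : realType) (f : homeo_plus R) x : (f^-1)%g (f x) = x.
Proof. by rewrite -[LHS]/((f^-1 * f)%g x) mulVg. Qed.

Lemma homeo_plusVK (R : realType) (f : homeo_plus R) x : f ((f^-1)%g x) = x.
Proof. by rewrite -[LHS]/((f * f^-1)%g x) mulgV. Qed.

Lemma homeo_plusV_gt (R : realType) (f : homeo_plus R) x :
  f x < x -> x < (f^-1)%g x.
Proof. by move=> /(homeo_plus_lt (f^-1)%g); rewrite homeo_plusK. Qed.

Lemma homeo_plusV_lt (R : realType) (f : homeo_plus R) x :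
  x < f x -> (f^-1)%g x < x.
Proof. by move=> /(homeo_plus_lt (f^-1)%g); rewrite homeo_plusK. Qed.

Lemma conjg_homeo (R : realType) (a b : homeo_plus R) x :
  a (b x) = b ((a ^ b)%g x).
Proof. by rewrite -[RHS]/((b * (b^-1 * (a * b)))%g x) mulVKg. Qed.

(** Each index i leaves a trace made of rationals: an interval ]p, q[ that a_i
    moves to the right and a point r of b_i(]p, q[), which a_i moves to the
    left.  Two indices cannot leave the same trace, because b_i(]p, q[) is then
    moved to the right by every other a_j. *)
Lemma klein_family_countable (R : realType) (I : Type)
    (a b : I -> homeo_plus R) :
  (forall i, a i <> 1%g) ->
  (forall i, (a i ^ b i = (a i)^-1)%g) ->
  (forall i j, i <> j -> (a i ^ b j = a i)%g) ->
  countable [set: I].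
Proof.
move=> a_neq1 abV abC.
have right i : exists x, x < a i x.
  have [[x aix]|/forallNP nx] := pselect (exists x, a i x <> x); last first.
    by case: (a_neq1 i); apply: homeo_plus_eq => x; apply: contrapT (nx x).
  have [lt|gt|//] := ltgtP (a i x) x; last by exists x.
  exists (b i x); rewrite conjg_homeo abV.
  exact/homeo_plus_lt/homeo_plusV_gt.
(* t = (p, q, r), where r lies in b_i(]p, q[). *)
have key i : exists t : rat * rat * rat,
    [/\ forall y, ratr t.1.1 < y < ratr t.1.2 -> y < a i y
      & ratr t.1.1 < ((b i)^-1)%g (ratr t.2) < ratr t.1.2].
  have [x xa] := right i.
  (* All of ]x, a_i x[ is moved to the right, past a_i x. *)
  have [p] := rat_in_itvoo xa; rewrite in_itv /= => /andP[xp pa].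
  have [q] := rat_in_itvoo pa; rewrite in_itv /= => /andP[pq qa].
  have [r] := rat_in_itvoo (homeo_plus_lt (b i) pq).
  rewrite in_itv /= => /andP[pr rq]; exists (p, q, r); split=> /=.
    move=> y /andP[py yq]; apply: (lt_trans yq); apply: (lt_trans qa).
    exact/homeo_plus_lt/(lt_trans xp).
  have := homeo_plus_lt (b i)^-1%g pr.
  have := homeo_plus_lt (b i)^-1%g rq.
  by rewrite !homeo_plusK => -> ->.
have [t tP] := choice key.
apply: (sub_countable (injective_card_le (f := t) _)) => // i j tij.
apply: contrapT => ij.
have [mi ri] := tP i; have [mj rj] := tP j; rewrite -tij in mj rj.
set r := ratr (t i).2 in ri rj.
(* a_j moves r to the right as a point of b_i(]p, q[), and to the left as a
   point of b_j(]p, q[). *)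
have : r < a j r.
  rewrite -[in ltRHS](homeo_plusVK (b i) r) conjg_homeo abC; last by move/esym.
  by rewrite -[ltLHS](homeo_plusVK (b i) r); apply/homeo_plus_lt/mj.
apply/negP; rewrite -leNgt ltW //.
rewrite -[in ltLHS](homeo_plusVK (b j) r) conjg_homeo abV.
rewrite -[ltRHS](homeo_plusVK (b j) r).
exact/homeo_plus_lt/homeo_plusV_lt/mj.
Qed.

(** * Sets with the cardinality of the continuum *)

Lemma card_le_set_nat (T : countType) : [set: set T] #<= [set: set nat].
Proof.
apply: (injective_card_le (f := fun A : set T => choice.pickle @` A)).
have mem A x := @image_inj T nat choice.pickle A x (pcan_inj choice.pickleK).
by move=> A B AB; apply/funext => x; rewrite -mem AB mem.
Qed.

Lemma set_nat_uncountable : ~ countable [set: set nat].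
Proof.
move=> /countable_injP[f finj].
pose D := [set n | exists A, f A = n /\ ~ A n].
have [DfD|nDfD] := pselect (D (f D)); last by apply: (nDfD); exists D.
by have [A [fAD nA]] := DfD; apply: nA; rewrite (finj _ _ _ _ fAD) ?inE.
Qed.

(** The rational points below the graph determine the homeomorphism: if
    f x < g x, then f < g on a whole interval to the left of x. *)
Lemma card_homeo_plus_le (R : realType) :
  [set: homeo_plus R] #<= [set: set nat].
Proof.
apply: (card_le_trans _ (card_le_set_nat (rat * rat)%type)).
pose cut (f : homeo_plus R) :=
  [set t : rat * rat | f (ratr t.1) < ratr t.2].
have ncut (f g : homeo_plus R) x : f x < g x -> cut f <> cut g.
  move=> fg.
  (* Between g^-1 (f x) and x, the value f x separates f from g. *)
  have : (g^-1)%g (f x) < x.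
    by rewrite -[ltRHS](homeo_plusK g); apply: homeo_plus_lt.
  move=> /rat_in_itvoo[p]; rewrite in_itv /= => /andP[gp px].
  have : f (ratr p) < g (ratr p).
    apply: (lt_trans (homeo_plus_lt f px)).
    by rewrite -[ltLHS](homeo_plusVK g); apply: homeo_plus_lt.
  move=> /rat_in_itvoo[q]; rewrite in_itv /= => /andP[fq qg] fgE.
  have : cut g (p, q) by rewrite -fgE.
  by rewrite /cut /= => /(lt_trans qg); rewrite ltxx.
apply: (injective_card_le (f := cut)) => f g fg; apply: homeo_plus_eq => x.
have [/ncut//|/ncut/(_ (esym fg))//|//] := ltgtP (f x) (g x).
Qed.

Section Ternary.
Variable R : realType.
Implicit Types A B : set nat.

Definition ternary_sum A n : R := \sum_(k < n | `[< A k >]) 3^-1 ^+ k.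

Lemma ternary_sumS A n :
  ternary_sum A n.+1 = ternary_sum A n + (if `[< A n >] then 3^-1 ^+ n else 0).
Proof. by rewrite /ternary_sum big_mkcond big_ord_recr -big_mkcond. Qed.

(** The real number whose base 3 digits are 1 at the elements of A and 0
    elsewhere.  In base 3, unlike base 2, the digits 0 and 1 determine the
    number. *)
Definition ternary A : R := sup (range (ternary_sum A)).

Lemma ternary_sum_le A m n : (m <= n)%N -> ternary_sum A m <= ternary_sum A n.
Proof.
elim: n => [|n IH]; first by rewrite leqn0 => /eqP->.
rewrite leq_eqVlt => /predU1P[->//|/IH /le_trans->//].
by rewrite ternary_sumS lerDl; case: ifP => // _; rewrite exprn_ge0 // invr_ge0.
Qed.

(** 3 / 2 * 3^-m is the sum of all 3^-k with k >= m, so the right-hand side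
    does not increase with m. *)
Lemma ternary_sum_upper A m n :
  ternary_sum A n <= ternary_sum A m + 3 / 2 * 3^-1 ^+ m.
Proof.
have [nm|/ltnW mn] := leqP n m.
  apply: le_trans (ternary_sum_le A nm) _.
  by rewrite lerDl mulr_ge0 ?exprn_ge0 ?divr_ge0 ?invr_ge0.
apply: (@le_trans _ _ (ternary_sum A n + 3 / 2 * 3^-1 ^+ n)).
  by rewrite lerDl mulr_ge0 ?exprn_ge0 ?divr_ge0 ?invr_ge0.
move: mn; elim: n => [|n IH]; first by rewrite leqn0 => /eqP->.
rewrite leq_eqVlt => /predU1P[->//|/IH]; apply: le_trans.
rewrite ternary_sumS exprS; have : 0 <= 3^-1 ^+ n :> R.
  by rewrite exprn_ge0 // invr_ge0.
by case: ifP => _; lra.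
Qed.

Lemma ternary_bounds A m :
  ternary_sum A m <= ternary A <= ternary_sum A m + 3 / 2 * 3^-1 ^+ m.
Proof.
apply/andP; split.
  apply: ub_le_sup; last by exists m.
  exists (ternary_sum A 0 + 3 / 2 * 3^-1 ^+ 0) => _ [n _ <-].
  exact: ternary_sum_upper.
apply: ge_sup; first by exists (ternary_sum A 0), 0%N.
by move=> _ [n _ <-]; exact: ternary_sum_upper.
Qed.

Lemma ternary_inj : injective ternary.
Proof.
move=> A B tAB; apply/funext => n; have [k] := ubnP n.
elim: k n => // k IH n /ltnSE nk.
have ABn : ternary_sum A n = ternary_sum B n.
  by apply: eq_bigl => i; rewrite (IH i) // (leq_trans (ltn_ord i)).
(* With a common partial sum S up to n, having n gives at least S + 3^-n, and
   lacking it gives at most S + 3^-n / 2. *)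
have := ternary_bounds A n.+1; have := ternary_bounds B n.+1.
rewrite tAB !ternary_sumS ABn exprS.
have : 0 < 3^-1 ^+ n :> R by rewrite exprn_gt0 // invr_gt0.
by case: asboolP => Bn; case: asboolP => An;
  try (by move=> *; exfalso; lra); move=> _ _ _; apply/propext.
Qed.

End Ternary.

Lemma is_homeo_plus_translation (R : realType) (c : R) :
  is_homeo_plus (fun x => c + x).
Proof.
apply/asboolP; split; last by move=> x y; rewrite ltrD2l.
exists (fun x => - c + x); split; [exact: addKr|exact: addNKr| |].
- by move=> x; apply: cvgD; [exact: cvg_cst|exact: cvg_id].
- by move=> x; apply: cvgD; [exact: cvg_cst|exact: cvg_id].
Qed.

Lemma card_homeo_plus_ge (R : realType) :
  [set: set nat] #<= [set: homeo_plus R].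
Proof.
pose tr A := HomeoPlus (is_homeo_plus_translation (ternary R A)).
apply: (injective_card_le (f := tr)) => A B.
move=> /(congr1 (fun f : homeo_plus R => f 0)).
by rewrite /= !addr0 => /ternary_inj.
Qed.

(** * The Klein bottle group *)

(** The pair (n, m) stands for b^n a^m.  With b on the left, left
    multiplication translates both coordinates of elements with the same n,
    which is what makes the lexicographic order left-invariant below. *)
Definition klein := (int * int)%type.
HB.instance Definition _ := Choice.on klein.

Section Klein.
Implicit Types x y z : klein.

Let sg (n : int) : int := (-1) ^ n.

Let sgD m n : sg (m + n) = sg m * sg n.
Proof. exact: exprzDr. Qed.

Let sgN n : sg (- n) = sg n.
Proof. by rewrite /sg -exprz_inv invrN1. Qed.

Let sgK n : sg n * sg n = 1.
Proof. by rewrite -{2}sgN -sgD subrr. Qed.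

Definition klein_mul x y : klein := (x.1 + y.1, sg y.1 * x.2 + y.2).
Definition klein_one : klein := (0, 0).
Definition klein_inv x : klein := (- x.1, - (sg x.1 * x.2)).

Lemma klein_mulA : associative klein_mul.
Proof.
move=> x y z; congr pair => /=; first by ring.
by rewrite sgD; ring.
Qed.

Lemma klein_mul1 : left_id klein_one klein_mul.
Proof. by move=> [n m]; rewrite /klein_mul /= mulr0 !add0r. Qed.

Lemma klein_mulr1 : right_id klein_one klein_mul.
Proof. by move=> [n m]; rewrite /klein_mul /= mul1r !addr0. Qed.

Lemma klein_mulV : left_inverse klein_one klein_inv klein_mul.
Proof. by move=> [n m]; rewrite /klein_mul /= mulrN mulrA sgK mul1r !addNr. Qed.

Lemma klein_mulrV : right_inverse klein_one klein_inv klein_mul.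
Proof. by move=> [n m]; rewrite /klein_mul /= sgN !subrr. Qed.

End Klein.

HB.instance Definition _ := isGroup.Build klein
  klein_mulA klein_mul1 klein_mulr1 klein_mulV klein_mulrV.

Definition klein_a : klein := (0, 1).
Definition klein_b : klein := (1, 0).

Lemma klein_a_neq1 : klein_a <> 1%g. Proof. by []. Qed.

Lemma klein_conj : (klein_a ^ klein_b)%g = (klein_a^-1)%g.
Proof. by []. Qed.

Lemma klein_left_orderable : left_orderable klein.
Proof.
exists (fun x y => (x.1 < y.1) || (x.1 == y.1) && (x.2 <= y.2)); split.
- by move=> x /=; rewrite eqxx lexx orbT.
- move=> [n m] [n' m'] /=; case: ltgtP => //= -> H; congr pair.
  exact: le_anti.
- move=> [n m] [n' m'] [n'' m''] /=; lia.
- by move=> [n m] [n' m'] /=; lia.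
- move=> x y z; rewrite /= ltrD2l (inj_eq (addrI _)).
  by case: (eqVneq y.1 z.1) => [->|_]; rewrite ?lerD2l.
Qed.

(** * Powers of a group with countable supports *)
Section Power.
Variables (I : choiceType) (K : groupType).

(** Countable supports keep the group small: if K has at most the cardinality
    of the continuum, so does the power indexed by the continuum, whereas the
    full power would be larger. *)
Definition countably_supported : pred (I -> K) :=
  fun f => countable [set i | f i <> 1%g].

Record sigma_power := SigmaPower {
  sigma_power_fun :> I -> K;
  sigma_power_subproof : countably_supported sigma_power_fun }.

HB.instance Definition _ := [isSub for sigma_power_fun].
HB.instance Definition _ := [Choice of sigma_power by <:].

Implicit Types f g h : sigma_power.

Lemma sigma_power_eq f g : f =1 g -> f = g.
Proof. by move=> fg; apply/val_inj/funext. Qed.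

Lemma sigma_powerP f : countable [set i | f i <> 1%g].
Proof. exact: sigma_power_subproof. Qed.

Lemma countably_supported_one : countably_supported (fun=> 1%g).
Proof.
by rewrite /countably_supported (_ : mkset _ = set0) // -subset0 => i.
Qed.

Lemma countably_supported_mul f g : countably_supported (fun i => f i * g i)%g.
Proof.
have : countable
    (\bigcup_n bigcup2 [set i | f i <> 1%g] [set i | g i <> 1%g] n).
  by apply: bigcup_countable => // -[|[|n]] _ //=; exact: sigma_powerP.
rewrite bigcup2E; apply: sub_countable.
apply: subset_card_le => i /= fg1; apply/not_andP => -[f1 g1]; apply: fg1.
by rewrite f1 g1 mulg1.
Qed.

Lemma countably_supported_inv f : countably_supported (fun i => (f i)^-1)%g.
Proof.
apply: (sub_countable _ (sigma_powerP f)).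
by apply: subset_card_le => i /= fV1 f1; apply: fV1; rewrite f1 invg1.
Qed.

Definition sigma_power_one := SigmaPower countably_supported_one.
Definition sigma_power_mul f g := SigmaPower (countably_supported_mul f g).
Definition sigma_power_inv f := SigmaPower (countably_supported_inv f).

Lemma sigma_power_mulA : associative sigma_power_mul.
Proof. by move=> f g h; apply: sigma_power_eq => i; exact: mulgA. Qed.

Lemma sigma_power_mul1 : left_id sigma_power_one sigma_power_mul.
Proof. by move=> f; apply: sigma_power_eq => i; exact: mul1g. Qed.

Lemma sigma_power_mulr1 : right_id sigma_power_one sigma_power_mul.
Proof. by move=> f; apply: sigma_power_eq => i; exact: mulg1. Qed.

Lemma sigma_power_mulV :
  left_inverse sigma_power_one sigma_power_inv sigma_power_mul.
Proof. by move=> f; apply: sigma_power_eq => i; exact: mulVg. Qed.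

Lemma sigma_power_mulrV :
  right_inverse sigma_power_one sigma_power_inv sigma_power_mul.
Proof. by move=> f; apply: sigma_power_eq => i; exact: mulgV. Qed.

HB.instance Definition _ := isGroup.Build sigma_power
  sigma_power_mulA sigma_power_mul1 sigma_power_mulr1
  sigma_power_mulV sigma_power_mulrV.

(** Lexicographic order for a well-order of the indices.  Only transitivity
    needs an argument: the first index j where f, g and h are not all equal
    is also the first one where f and h differ, for otherwise f j = h j, and
    f j <= g j <= h j would make all three equal. *)
Lemma sigma_power_left_orderable :
  left_orderable K -> left_orderable sigma_power.
Proof.
move=> [le [le_refl le_anti le_trans le_total leM]].
have [R Rwo] := well_ordering_principle I.
have Rmin (P : I -> Prop) : (exists i, P i) ->
    exists2 i, P i & forall j, P j -> R i j.
  move=> [i Pi]; have [|m [[Pm mP] _]] := Rwo [pred i | `[< P i >]].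
    by exists i; exact/asboolP.
  by exists m => [|j Pj]; [exact/asboolP|exact/mP/asboolP].
have Ranti i j : R i j -> R j i -> i = j.
  move=> ij ji; apply: (wo_chain_antisymmetric (C := predT) (R := R)) => //.
    by move=> A _; exact: Rwo.
  by rewrite ij ji.
pose first f g i := f i <> g i /\ forall j, f j <> g j -> R i j.
have firstP f g : f <> g -> exists i, first f g i.
  move=> fg; have [|i fgi iP] := Rmin (fun i => f i <> g i); last by exists i.
  by apply/existsNP => fgE; apply: fg; exact: sigma_power_eq.
exists (fun f g => `[< forall i, first f g i -> le (f i) (g i) >]); split.
- by move=> f; apply/asboolP => i [].
- move=> f g /andP[/asboolP fg /asboolP gf]; apply: contrapT => /firstP[i fgi].
  have gfi : first g f i.
    by case: fgi => ne min; split=> [/esym//|j /nesym]; exact: min.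
  by case: fgi.1; apply: le_anti; rewrite fg // gf.
- move=> g f h /asboolP fg /asboolP gh; apply/asboolP => i [fhi fhP].
  have [|j fgh jP] := Rmin (fun j => f j <> g j \/ g j <> h j).
    exists i; have [fgi|] := pselect (f i = g i); last by left.
    by right; rewrite -fgi.
  have ji : i = j.
    apply: Ranti.
      apply: fhP => fhj; have fgj : f j <> g j.
        by case: fgh => // /[swap] fgj; rewrite -fhj fgj.
      apply: fgj; apply: le_anti; rewrite fg; last first.
        split=> [|k fgk]; last by apply: jP; left.
        by case: fgh => //; rewrite -fhj => /nesym.
      rewrite fhj gh //; split; last by move=> k ghk; apply: jP; right.
      by case: fgh => //; rewrite fhj => /nesym.
    apply: jP; have [fgi|] := pselect (f i = g i); last by left.
    by right; rewrite -fgi.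
  apply: (@le_trans (g i)).
    have [->//|fgi] := pselect (f i = g i).
    by apply: fg; split=> // k fgk; rewrite ji; apply: jP; left.
  have [->//|ghi] := pselect (g i = h i).
  by apply: gh; split=> // k ghk; rewrite ji; apply: jP; right.
- move=> f g; apply/orP; have [->|fg] := pselect (f = g).
    by left; apply/asboolP => i [].
  have [i [fgi iP]] := firstP _ _ fg.
  have /orP[lei|lei] := le_total (f i) (g i); [left|right];
    apply/asboolP => j [].
    by move=> fgj jP; rewrite -(Ranti i j) //; [exact: iP|exact: jP].
  move=> /nesym fgj jP; rewrite -(Ranti i j) //; first exact: iP.
  by apply: jP => /esym.
- move=> f g h /asboolP gh; apply/asboolP => i [fghi iP]; apply: leM; apply: gh.
  split=> [ghi|j ghj]; first by apply: fghi; rewrite /= ghi.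
  by apply: iP => /mulgI.
Qed.

Definition sigma_delta (i : I) (x : K) : I -> K :=
  fun j => if j == i then x else 1%g.

Lemma countably_supported_delta i x : countably_supported (sigma_delta i x).
Proof.
apply: (sub_countable _ (countable1 i)); apply: subset_card_le.
by move=> j /=; rewrite /sigma_delta; case: eqP.
Qed.

Definition sigma_single i x := SigmaPower (countably_supported_delta i x).

Lemma sigma_singleJ i x y :
  (sigma_single i x ^ sigma_single i y = sigma_single i (x ^ y))%g.
Proof.
apply: sigma_power_eq => j.
rewrite -[LHS]/((sigma_delta i x j) ^ (sigma_delta i y j))%g /= /sigma_delta.
by case: eqP => // _; exact: conj1g.
Qed.

Lemma sigma_singleV i x : ((sigma_single i x)^-1 = sigma_single i x^-1)%g.
Proof.
apply: sigma_power_eq => j; rewrite /= /sigma_delta.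
by case: eqP => // _; exact: invg1.
Qed.

Lemma sigma_singleJ_neq i j x y :
  i <> j -> (sigma_single i x ^ sigma_single j y = sigma_single i x)%g.
Proof.
move=> ij; apply: sigma_power_eq => k.
rewrite -[LHS]/((sigma_delta i x k) ^ (sigma_delta j y k))%g /= /sigma_delta.
have [->|_] := eqVneq k j; last exact: conjg1.
by case: eqP => [/esym//|_]; exact: conj1g.
Qed.

Lemma sigma_single_inj x : x <> 1%g -> injective (sigma_single ^~ x).
Proof.
move=> x1 i j /(congr1 (fun f : sigma_power => f i)) /=.
by rewrite /sigma_delta eqxx; case: eqP.
Qed.

End Power.

(** * Cardinality of the power and proof of the theorem *)

(** If e enumerates the support of f, then f is determined by e and by the
    values f \o e.  The range of e may exceed the support, so an empty support
    needs no separate treatment. *)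
Lemma card_sigma_power_le (I : pointedType) (K : groupType) :
  [set: sigma_power I K] #<= [set: (nat -> I) * (nat -> K)].
Proof.
have enum (f : sigma_power I K) :
    exists e : nat -> I, forall i, f i <> 1%g -> exists n, e n = i.
  have /pcard_surjP[e eP] := sigma_powerP f.
  by exists e => i /eP[n _ <-]; exists n.
have [e eP] := choice enum.
apply: (injective_card_le (f := fun f : sigma_power I K => (e f, f \o e f))).
move=> f g [efg fg]; apply: sigma_power_eq => i.
have [[n <-]|nex] := pselect (exists n, e f n = i).
  by rewrite {2}efg -[LHS]/((f \o e f) n) fg.
have [fi|/eP/nex//] := pselect (f i = 1%g).
have [->//|/eP] := pselect (g i = 1%g).
by rewrite -efg => /nex.
Qed.

(** A sequence of subsets of nat is a subset of nat * nat, and a sequence in C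
    is its graph, a subset of nat * C. *)
Lemma card_sequences_le (C : countType) :
  [set: (nat -> set nat) * (nat -> C)] #<= [set: set nat].
Proof.
apply: (card_le_trans _ (card_le_set_nat (nat * nat + nat * C)%type)).
pose code (u : (nat -> set nat) * (nat -> C)) :
    set (nat * nat + nat * C)%type :=
  [set t | match t with inl p => u.1 p.1 p.2 | inr p => u.2 p.1 = p.2 end].
apply: (injective_card_le (f := code)) => -[A c] [B d] codeE.
have mem t : code (A, c) t = code (B, d) t by rewrite codeE.
congr pair; apply/funext => n.
  by apply/funext => k; exact: (mem (inl (n, k))).
have := mem (inr (n, c n)).
by rewrite /code /= => /esym; rewrite propeqE => -[_ ->].
Qed.

Theorem corollary1p5 (R : realType) :
  exists G : groupType,
    [/\ left_orderable G,
        [set: G] #= [set: homeo_plus R] &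
        ~ exists f : {multiplicative G -> homeo_plus R}, injective f].
Proof.
exists (sigma_power (set nat) klein); split.
- exact/sigma_power_left_orderable/klein_left_orderable.
- rewrite card_eq_le; apply/andP; split.
    apply: card_le_trans (card_homeo_plus_ge R).
    apply: card_le_trans (card_sigma_power_le _ _) _.
    exact: (card_sequences_le (int * int)%type).
  apply: card_le_trans (card_homeo_plus_le R) _.
  exact/injective_card_le/sigma_single_inj/klein_a_neq1.
- move=> [f finj]; apply: set_nat_uncountable.
  have f1 : f 1%g = 1%g by apply: (mulgI (f 1%g)); rewrite -gmulfM !mulg1.
  have fV x : f x^-1%g = (f x)^-1%g.
    by apply: (mulgI (f x)); rewrite -gmulfM !mulgV.
  have fJ x y : f (x ^ y)%g = (f x ^ f y)%g by rewrite !gmulfM fV.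
  apply: (@klein_family_countable R _ (fun i => f (sigma_single i klein_a))
            (fun i => f (sigma_single i klein_b))) => [i|i|i j ij].
  + rewrite -f1 => /finj /(congr1 (fun g : sigma_power _ _ => g i)) /=.
    by rewrite /sigma_delta eqxx; exact: klein_a_neq1.
  + by rewrite -fJ sigma_singleJ klein_conj -sigma_singleV fV.
  + by rewrite -fJ sigma_singleJ_neq.
Qed.
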